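(* Let $k,\ell\in \mathbb{N}_{\geq 2}$ be multiplicatively independent. Then the theory $\mathrm{FO}(\mathbb{N},+,k^{\mathbb{N}},\ell^{\mathbb{N}})$ has the $2$-independence property.
   Context: $k$ and $\ell$ are multiplicatively independent if $k^a\neq \ell^b$ for all nonzero $a,b\in\mathbb{Z}$; $k^{\mathbb{N}}=\{k^i:i\in\mathbb{N}\}$ is a unary predicate, and $\mathrm{FO}(\mathbb{N},+,k^{\mathbb{N}},\ell^{\mathbb{N}})$ is the complete first-order theory of the structure $(\mathbb{N},+,k^{\mathbb{N}},\ell^{\mathbb{N}})$. A first-order theory $T$ has the $k$-independence property if there is a formula $\varphi(x,y_1,\dots,y_k)$ in the language of $T$ (where $x,y_i$ may be tuples of variables) such that for every $n\in\mathbb{N}$ there are a model $M$ of $T$ and elements $a_{i,j}\in M$ for $i\in\{1,\dots,k\}$, $j\in\{0,\dots,n-1\}$ such that for every $S\subseteq\{0,\dots,n-1\}^k$ there is $b_S\in M$ with $M\models \varphi(b_S,a_{1,j_1},\dots,a_{k,j_k})$ if and only if $(j_1,\dots,j_k)\in S$. *)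

(* Defs.v *)
From HB Require Import structures.
From mathcomp Require Import all_boot all_order all_algebra.
Set Implicit Arguments.
Unset Strict Implicit.
Unset Printing Implicit Defensive.
Import Order.TTheory GRing.Theory Num.Theory.

Record language := Language {
  fsym : Type;
  rsym : Type;
  farity : fsym -> nat;
  rarity : rsym -> nat
}.

Inductive term (L : language) (V : Type) : Type :=
| Var (x : V)
| App (f : fsym L) (args : 'I_(farity f) -> term L V).

(* [formula L V] is the type of first-order L-formulas, with equality, whose
   free variables are taken from V.  Under a quantifier, [None] is the bound
   variable and [Some x] is the outer variable x. *)
Inductive formula (L : language) (V : Type) : Type :=
| FEq (t u : term L V)
| FRel (r : rsym L) (args : 'I_(rarity r) -> term L V)
| FFalse
| FImp (A B : formula L V)
| FAnd (A B : formula L V)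
| FOr (A B : formula L V)
| FAll (A : formula L (option V))
| FEx (A : formula L (option V)).

Arguments Var {L V} x.
Arguments App {L V} f args.
Arguments FEq {L V} t u.
Arguments FRel {L V} r args.
Arguments FFalse {L V}.
Arguments FImp {L V} A B.
Arguments FAnd {L V} A B.
Arguments FOr {L V} A B.
Arguments FAll {L V} A.
Arguments FEx {L V} A.

Definition sentence (L : language) : Type := formula L void.

Definition theory (L : language) : Type := sentence L -> Prop.

Record structure (L : language) := Structure {
  carrier :> Type;
  carrier_inhabited : inhabited carrier;
  finterp : forall f : fsym L, ('I_(farity f) -> carrier) -> carrier;
  rinterp : forall r : rsym L, ('I_(rarity r) -> carrier) -> Prop
}.

Arguments finterp {L} s f args.
Arguments rinterp {L} s r args.

Fixpoint eval (L : language) (M : structure L) (V : Type) (e : V -> M)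
    (t : term L V) : M :=
  match t with
  | Var x => e x
  | App f args => finterp M f (fun i => eval e (args i))
  end.

Definition extend (A V : Type) (e : V -> A) (a : A) (x : option V) : A :=
  if x is Some y then e y else a.

Fixpoint sat (L : language) (M : structure L) (V : Type) (e : V -> M)
    (A : formula L V) {struct A} : Prop :=
  match A with
  | FEq t u => eval e t = eval e u
  | FRel r args => rinterp M r (fun i => eval e (args i))
  | FFalse => False
  | FImp B C => sat e B -> sat e C
  | FAnd B C => sat e B /\ sat e C
  | FOr B C => sat e B \/ sat e C
  | FAll B => forall a : M, sat (extend e a) B
  | FEx B => exists a : M, sat (extend e a) B
  end.

Definition holds (L : language) (M : structure L) (A : sentence L) : Prop :=
  sat (of_void M) A.

Definition is_model (L : language) (M : structure L) (T : theory L) : Prop :=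
  forall A : sentence L, T A -> holds M A.

Definition complete_theory (L : language) (M : structure L) : theory L :=
  fun A => holds M A.

(* The free variables of a formula phi(x, y_1, ..., y_k) in which x is a
   p-tuple of variables and each y_i is a (q i)-tuple. *)
Definition ip_var (k p : nat) (q : 'I_k -> nat) : Type :=
  ('I_p + {i : 'I_k & 'I_(q i)})%type.

Definition ip_env (A : Type) (k p : nat) (q : 'I_k -> nat)
    (b : 'I_p -> A) (a : forall i : 'I_k, 'I_(q i) -> A)
    (v : ip_var p q) : A :=
  match v with
  | inl x => b x
  | inr y => a (tag y) (tagged y)
  end.

Definition independence_property (k : nat) (L : language) (T : theory L)
    : Prop :=
  exists (p : nat) (q : 'I_k -> nat) (phi : formula L (ip_var p q)),
  forall n : nat,
  exists M : structure L, is_model M T /\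
  exists a : forall i : 'I_k, 'I_n -> ('I_(q i) -> M),
  forall S : {set {ffun 'I_k -> 'I_n}},
  exists b : 'I_p -> M,
  forall j : {ffun 'I_k -> 'I_n},
    sat (ip_env b (fun i => a i (j i))) phi <-> j \in S.

Definition mult_independent (k l : nat) : Prop :=
  forall a b : int, a <> 0%R -> b <> 0%R ->
    ((k%:R : rat) ^ a <> (l%:R : rat) ^ b)%R.

Inductive add_sym : Set := Add.

Inductive pow_sym : Set := PowK | PowL.

Definition add_pow_language : language :=
  {| fsym := add_sym;
     rsym := pow_sym;
     farity := fun=> 2;
     rarity := fun=> 1 |}.

Definition is_power (k m : nat) : Prop := exists i : nat, m = k ^ i.

Definition nat_add_pow (k l : nat) : structure add_pow_language :=
  @Structure add_pow_language nat (inhabits 0)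
    (fun _ args => args ord0 + args ord_max)
    (fun r args =>
       match r with
       | PowK => is_power k (args ord0)
       | PowL => is_power l (args ord0)
       end).

(* Main.v *)
Require Import Defs.
From mathcomp Require Import all_boot all_order all_algebra.
From mathcomp Require Import ring lra zify.
From Stdlib Require Import Classical.
Set Implicit Arguments.
Unset Strict Implicit.
Unset Printing Implicit Defensive.
Import Order.TTheory GRing.Theory Num.Theory.

(* At the scale c = k^M, and with th = l^N / k^M, the differences
   k^(M+p) - l^(N+q) are c (k^p - th l^q).  For a suitable th these values hit
   any prescribed finite sequence of unit intervals ("cells") below T, in order
   of increasing p and with no other value in [0, T]: such a th is found in
   nested intervals, and th is then replaced by some l^N / k^M since the ratios
   k^p / l^q are dense.  So every subset of {0, ..., T - 1} is the set of cells
   hit within some window P1 < p <= P2.  The window is definable from b_S,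
   the scale c and the numbers c y are the same for all windows, and y can be
   split additively as n i + j, which makes one formula shatter an n x n grid. *)

(** * Density of the ratios [k ^ p / l ^ q] *)

Lemma mult_independent_expn (k l a b : nat) :
  2 <= k -> mult_independent k l -> 0 < a -> k ^ a <> l ^ b.
Proof.
move=> k2 kl a0 E.
(* Independence speaks of nonzero exponents only; for [b = 0] the power [k ^ a] exceeds 1. *)
case: b E => [|b] E.
  have := ltn_expl a k2; rewrite E expn0; lia.
have a' : Posz a <> 0%R by lia.
have b' : Posz b.+1 <> 0%R by lia.
by apply: kl a' b' _; rewrite -!exprnP -!natrX E.
Qed.

Section Rational.
Local Open Scope ring_scope.

Lemma expr_unbounded (x c : rat) : 1 < x -> 0 <= c -> exists m : nat, c < x ^+ m.
Proof.
move=> x1 c0.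
have bern (m : nat) : 1 + m%:R * (x - 1) <= x ^+ m.
  elim: m => [|m IH]; first by rewrite mul0r addr0 expr0.
  have m0 : 0 <= m%:R :> rat by rewrite ler0n.
  have step : 0 <= (x - 1) * (x ^+ m - (1 + m%:R * (x - 1))).
    by apply: mulr_ge0; lra.
  have sq : 0 <= m%:R * ((x - 1) * (x - 1)).
    by apply: mulr_ge0 => //; apply: mulr_ge0; lra.
  rewrite exprS -natr1; lra.
exists (Num.bound (c / (x - 1))).
apply: lt_le_trans (bern _).
have : c / (x - 1) < (Num.bound (c / (x - 1)))%:R.
  by apply: archi_boundP; rewrite divr_ge0 //; lra.
rewrite ltr_pdivrMr; lra.
Qed.

Lemma natr_ge2 (k : nat) : (2 <= k)%N -> 2 <= k%:R :> rat.
Proof. by move=> k2; rewrite (ler_nat _ 2 k). Qed.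

(* Subtractive Euclid on logarithms: if both ratios stay at least [1 + e],
   each division shrinks their product by [1 + e]. *)
Lemma ratio_near1 (k l : nat) (e : rat) :
  (2 <= k)%N -> (2 <= l)%N -> mult_independent k l -> 0 < e ->
  exists a b : nat, (1 < k%:R ^+ a / l%:R ^+ b :> rat) && (k%:R ^+ a / l%:R ^+ b < 1 + e) \/
    (1 < l%:R ^+ b / k%:R ^+ a :> rat) && (l%:R ^+ b / k%:R ^+ a < 1 + e).
Proof.
move=> k2 l2 kl e0; have K2 := natr_ge2 k2; have L2 := natr_ge2 l2.
set K : rat := k%:R in K2 *; set L : rat := l%:R in L2 *.
have K0 a : 0 < K ^+ a by apply: exprn_gt0; lra.
have L0 a : 0 < L ^+ a by apply: exprn_gt0; lra.
have step (n : nat) :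
    (exists a b : nat, (1 < K ^+ a / L ^+ b < 1 + e) \/
                       (1 < L ^+ b / K ^+ a < 1 + e)) \/
    exists a b c d : nat, [/\ 1 < K ^+ a / L ^+ b, 1 < L ^+ d / K ^+ c &
      (K ^+ a / L ^+ b) * (L ^+ d / K ^+ c) * (1 + e) ^+ n <= K * L].
  elim: n => [|n [|[a [b [c [d [x1 y1 xy]]]]]]]; last 2 first.
  - by left.
  - set x := K ^+ a / L ^+ b in x1 xy; set y := L ^+ d / K ^+ c in y1 xy.
    have [xe|xe] := ltrP x (1 + e).
      by left; exists a, b; left; rewrite x1 xe.
    have [ye|ye] := ltrP y (1 + e).
      by left; exists c, d; right; rewrite y1 ye.
    right.
    have a0 : (0 < a)%N.
      case: a @x x1 {xy xe} => [|//] /=; rewrite expr0 ltr_pdivlMr // mul1r.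
      by rewrite ltNge exprn_ege1 //; lra.
    have xdy : x / y = K ^+ (a + c) / L ^+ (b + d).
      by rewrite /x /y !exprD; field; rewrite !gt_eqF.
    have ydx : y / x = L ^+ (b + d) / K ^+ (a + c).
      by rewrite /x /y !exprD; field; rewrite !gt_eqF.
    have e1 : 0 < (1 + e) ^+ n by apply: exprn_gt0; lra.
    have x0 : 0 <= x by lra.
    have y0 : 0 <= y by lra.
    case: (ltgtP x y) => [lxy|lyx|exy].
    + exists a, b, (a + c)%N, (b + d)%N; rewrite -ydx -/x; split=> //.
        by rewrite ltr_pdivlMr; lra.
      have -> : x * (y / x) = y by field; rewrite gt_eqF //; lra.
      have := mulr_ge0 (mulr_ge0 y0 (ltW e1)) (_ : 0 <= x - (1 + e)).
      by rewrite exprS subr_ge0 => /(_ xe); lra.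
    + exists (a + c)%N, (b + d)%N, c, d; rewrite -xdy -/y; split=> //.
        by rewrite ltr_pdivlMr; lra.
      have -> : x / y * y = x by field; rewrite gt_eqF //; lra.
      have := mulr_ge0 (mulr_ge0 x0 (ltW e1)) (_ : 0 <= y - (1 + e)).
      by rewrite exprS subr_ge0 => /(_ ye); lra.
    (* Equal ratios would give [k ^ (a + c) = l ^ (b + d)] with [a > 0], against independence. *)
    + exfalso; have : x / y = 1 by rewrite exy divff // gt_eqF //; lra.
      rewrite xdy => /(congr1 ( *%R^~ (L ^+ (b + d)))).
      rewrite mul1r divfK ?gt_eqF // /K /L -!natrX => /eqP.
      rewrite eqr_nat => /eqP; apply: mult_independent_expn => //.
      by rewrite addn_gt0 a0.
  right; exists 1%N, 0%N, 0%N, 1%N; rewrite !expr0 !expr1 !divr1; split; lra.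
(* Both ratios exceed 1, so the product bound must fail once [(1 + e) ^ m] passes [K * L]. *)
have [m me] : exists m, K * L < (1 + e) ^+ m.
  by apply: expr_unbounded; [lra | apply: mulr_ge0; lra].
case: (step m) => // -[a [b [c [d [x1 y1 xy]]]]]; exfalso.
have xy1 : 1 <= K ^+ a / L ^+ b * (L ^+ d / K ^+ c).
  by rewrite -[1]mulr1; apply: ler_pM; lra.
have em : 0 <= (1 + e) ^+ m by apply: exprn_ge0; lra.
by have := ler_wpM2r em xy1; lra.
Qed.

(** A geometric progression cannot jump over [(al, be)] if its ratio lies strictly between 1 and
    [be / al]. With ratio [k ^ a / l ^ b] it climbs from a start at most [al]; with [l ^ b / k ^ a]
    it descends from a start at least [be]. Either way [p] never falls below its initial value. *)
Lemma ratio_dense (k l p0 : nat) (al be : rat) :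
  (2 <= k)%N -> (2 <= l)%N -> mult_independent k l -> 0 < al -> al < be ->
  exists p q : nat, (p0 < p)%N /\ al < k%:R ^+ p / l%:R ^+ q < be.
Proof.
move=> k2 l2 kl al0 albe; have K2 := natr_ge2 k2; have L2 := natr_ge2 l2.
have e0 : 0 < be / al - 1 by rewrite subr_gt0 ltr_pdivlMr // mul1r.
have [a [b ab]] := ratio_near1 k2 l2 kl e0.
set K : rat := k%:R in K2 ab *; set L : rat := l%:R in L2 ab *.
have K0 i : 0 < K ^+ i by apply: exprn_gt0; lra.
have L0 i : 0 < L ^+ i by apply: exprn_gt0; lra.
have shift p q m :
    K ^+ (p + a * m) / L ^+ (q + b * m)
      = K ^+ p / L ^+ q * (K ^+ a / L ^+ b) ^+ m.
  by rewrite expr_div_n !exprD !exprM; field; rewrite !gt_eqF //= exprn_gt0.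
case: ab => /andP[x1 xe].
- have [q zq] : exists q, K ^+ p0.+1 / al < L ^+ q.
    by apply: expr_unbounded; [lra | apply: divr_ge0; [exact: ltW | lra]].
  set x := K ^+ a / L ^+ b in x1 xe shift; set z := K ^+ p0.+1 / L ^+ q.
  have z0 : 0 < z by rewrite divr_gt0.
  have zal : z <= al.
    by move: zq; rewrite /z ltr_pdivrMr // ler_pdivrMr //; lra.
  have [m0 hm0] : exists m, al / z < x ^+ m.
    by apply: expr_unbounded => //; apply: divr_ge0; lra.
  have exm : exists m, al < z * x ^+ m.
    by exists m0; move: hm0; rewrite ltr_pdivrMr // mulrC.
  case: (ex_minnP exm) => -[|m] hm mmin; first by move: hm; rewrite expr0; lra.
  exists (p0.+1 + a * m.+1)%N, (q + b * m.+1)%N; rewrite shift -/z; split; first by clear; lia.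
  rewrite hm /=.
  have zm : z * x ^+ m <= al by rewrite leNgt; apply/negP => /mmin; rewrite ltnn.
  have xb : x < be / al by lra.
  move: xb; rewrite ltr_pdivlMr // exprS => xb.
  by nra.
- have [p hp] : exists p, be < K ^+ p by apply: expr_unbounded; lra.
  set y := L ^+ b / K ^+ a in x1 xe.
  have xy : K ^+ a / L ^+ b = y^-1 by rewrite /y invf_div.
  rewrite xy in shift; set z := K ^+ (p + p0.+1) / L ^+ 0.
  have zbe : be <= z.
    rewrite /z expr0 divr1 exprD; have : 1 <= K ^+ p0.+1 by apply: exprn_ege1; lra.
    by have := K0 p; nra.
  have y0 : 0 < y by lra.
  have [m0 hm0] : exists m, z / be < y ^+ m.
    by apply: expr_unbounded => //; apply: divr_ge0; lra.
  have exm : exists m, z * y^-1 ^+ m < be.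
    exists m0; move: hm0; rewrite exprVn ltr_pdivrMr ?ltr_pdivrMr ?exprn_gt0 //; lra.
  case: (ex_minnP exm) => -[|m] hm mmin; first by move: hm; rewrite expr0; lra.
  exists (p + p0.+1 + a * m.+1)%N, (0 + b * m.+1)%N; rewrite shift -/z; split; first by clear; lia.
  rewrite hm andbT.
  have zm : be <= z * y^-1 ^+ m by rewrite leNgt; apply/negP => /mmin; rewrite ltnn.
  have yb : y < be / al by lra.
  move: yb; rewrite ltr_pdivlMr // => yb.
  rewrite exprSr mulrA ltr_pdivlMr //; lra.
Qed.

(** * Nested intervals of [th] and the next prescribed hit *)

(** For fixed [P], [Q], [t] the admissible [th] form an open interval; these are the intervals that
    get nested. *)
Definition cell (k l P Q t : nat) (th : rat) : bool :=
  t%:R < k%:R ^+ P - th * l%:R ^+ Q < t.+1%:R.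

Lemma least_fst (R : nat -> nat -> Prop) :
  (exists p q, R p q) ->
  exists p q, R p q /\ forall p' q', (p' < p)%N -> ~ R p' q'.
Proof.
move=> [p]; elim/ltn_ind: p => p IH [q Rpq].
have [[p' [q' [lp Rp]]]|no] :=
  classic (exists p' q', (p' < p)%N /\ R p' q').
  by apply: (IH p') => //; exists q'.
by exists p, q; split=> // p' q' lp Rp; apply: no; exists p', q'.
Qed.

Lemma leq_natr1 (m n : nat) : (m < n)%N -> m%:R + 1 <= n%:R :> rat.
Proof. by move=> mn; rewrite natr1 ler_nat. Qed.

(* For [a = p - P] and [b = q - Q >= 0] the value is [k ^ P * (k ^ a - l ^ b)]
   up to [T * l ^ b], and the bracket is a nonzero integer. *)
Lemma cell_no_hit_near (k l T s P Q t : nat) (th : rat) :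
  (2 <= k)%N -> (2 <= l)%N -> mult_independent k l ->
  (T * (k ^ s).+1 < k ^ P)%N -> (t < T)%N -> cell k l P Q t th ->
  forall p q : nat, (P < p <= P + s)%N ->
    ~ (0 <= k%:R ^+ p - th * l%:R ^+ q <= T%:R).
Proof.
move=> k2 l2 kl hP tT /andP[th1 th2] p q /andP[Pp pPs] /andP[h1 h2].
have K2 := natr_ge2 k2; have L2 := natr_ge2 l2.
have hP' : T%:R * (k%:R ^+ s + 1) < k%:R ^+ P :> rat.
  by move: hP; rewrite -(ltr_nat rat) natrM -natr1 !natrX.
have tT' := leq_natr1 tT; have t0 : 0 <= t%:R :> rat by rewrite ler0n.
rewrite -natr1 in th2.
have [a ap] : exists a, p = (P + a.+1)%N.
  by exists (p - P.+1)%N; rewrite addnS -addSn subnKC.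
have KaKs : k%:R ^+ a.+1 <= k%:R ^+ s :> rat.
  by rewrite ler_weXn2l -1?(leq_add2l P) -1?ap //; lra.
have Ka2 : 2 <= k%:R ^+ a.+1 :> rat.
  have : 1 <= k%:R ^+ a :> rat by apply: exprn_ege1; lra.
  by move=> Ka1; rewrite exprS -[2]mulr1; apply: ler_pM; lra.
move: h1 h2; rewrite ap exprD.
have [Qq|qQ] := leqP Q q.
- have [b bq] : exists b, q = (Q + b)%N by exists (q - Q)%N; rewrite subnKC.
  rewrite bq exprD [th * _]mulrA.
  have B1 : 1 <= l%:R ^+ b :> rat by apply: exprn_ege1; lra.
  move: th1 th2 hP'.
  set A := k%:R ^+ P; set X := th * _ => th1 th2 hP' h1 h2.
  have A0 : 0 < A by apply: exprn_gt0; lra.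
  have : (k ^ a.+1 != l ^ b)%N by apply/eqP/mult_independent_expn.
  rewrite neq_ltn => /orP[] /leq_natr1; rewrite !natrX => lab.
  (* Here the value is at most [T * (k ^ s + 1) - k ^ P], hence negative. *)
  + have := ler_wpM2l (_ : 0 <= A - T%:R) lab.
    have := ler_wpM2r (_ : 0 <= l%:R ^+ b) (_ : A - T%:R <= X).
    have TK : T%:R * k%:R ^+ a.+1 <= T%:R * k%:R ^+ s :> rat by apply: ler_wpM2l; lra.
    move=> /(_ ltac:(lra) ltac:(lra)) i1.
    have TK0 : 0 <= T%:R * k%:R ^+ a.+1 :> rat by apply: mulr_ge0; lra.
    move=> /(_ ltac:(lra)); lra.
  (* Here the value is at least [k ^ P], hence above [T]. *)
  + have := ler_wpM2l (ltW A0) lab.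
    have := ler_wpM2r (_ : 0 <= l%:R ^+ b) (_ : X <= A).
    move=> /(_ ltac:(lra) ltac:(lra)) i1.
    have TK0 : 0 <= T%:R * k%:R ^+ s :> rat by apply: mulr_ge0; lra.
    lra.
(* For [q < Q], less than [k ^ P] is subtracted from at least [2 * k ^ P], which leaves more than
   [T]. *)
- have A0 : 0 < k%:R ^+ P :> rat by apply: exprn_gt0; lra.
  have TK0 : 0 <= T%:R * k%:R ^+ s :> rat by apply: mulr_ge0; lra.
  have X0 : 0 < l%:R ^+ Q :> rat by apply: exprn_gt0; lra.
  have th0 : 0 <= th.
    by rewrite -(pmulr_lge0 _ X0); lra.
  have Lq : l%:R ^+ q <= l%:R ^+ Q :> rat by rewrite ler_weXn2l //; [lra | exact: ltnW].
  have := ler_wpM2l th0 Lq.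
  have := ler_wpM2l (ltW A0) Ka2.
  lra.
Qed.

(** The term [th * l ^ Q] lies between [k ^ P - T] and [k ^ P]. A smaller [q] at least halves it,
    leaving a value above [T]; a larger one at least doubles it, making the value negative. *)
Lemma cell_hit_unique (k l T P Q t : nat) (th : rat) :
  (2 <= k)%N -> (2 <= l)%N ->
  (2 * T < k ^ P)%N -> (t < T)%N -> cell k l P Q t th ->
  forall q : nat, 0 <= k%:R ^+ P - th * l%:R ^+ q <= T%:R -> q = Q.
Proof.
move=> k2 l2 hP tT /andP[th1 th2] q /andP[h1 h2].
have K2 := natr_ge2 k2; have L2 := natr_ge2 l2.
have hP' : 2 * T%:R < k%:R ^+ P :> rat.
  by move: hP; rewrite -(ltr_nat rat) natrM !natrX.
have tT' := leq_natr1 tT; have t0 : 0 <= t%:R :> rat by rewrite ler0n.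
rewrite -natr1 in th2.
have dbl (i j : nat) : (i < j)%N -> 0 <= th -> 2 * (th * l%:R ^+ i) <= th * l%:R ^+ j.
  move=> ij th0; rewrite mulrCA; apply: ler_wpM2l => //.
  apply: (@le_trans _ _ (l%:R ^+ i.+1)).
    by rewrite exprS; apply: ler_wpM2r => //; apply: exprn_ge0; lra.
  by rewrite ler_weXn2l //; lra.
have X0 : 0 < l%:R ^+ Q :> rat by apply: exprn_gt0; lra.
have th0 : 0 <= th by rewrite -(pmulr_lge0 _ X0); lra.
case: (ltngtP q Q) => // ij; exfalso; have := dbl _ _ ij th0; lra.
Qed.

(* [P'] is the least [p > P + s] such that some [k ^ p / l ^ q] lies in an
   interval slightly shorter than the cell, enlarged on both sides by
   [g p = C / k ^ p].  Since [g] at least halves at each step, an earlier [p]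
   with a value in [0, T] would have qualified. *)
Lemma next_hit (k l T s P Q t t' : nat) :
  (2 <= k)%N -> (2 <= l)%N -> mult_independent k l ->
  (8 * T < k ^ s)%N -> (T * (k ^ s).+1 < k ^ P)%N -> (t < T)%N -> (t' < T)%N ->
  exists P' Q' : nat, (P < P')%N /\
    forall th : rat, cell k l P' Q' t' th ->
      cell k l P Q t th /\
      forall p q : nat, (P < p < P')%N ->
        ~ (0 <= k%:R ^+ p - th * l%:R ^+ q <= T%:R).
Proof.
move=> k2 l2 kl hs hP tT t'T.
have K2 := natr_ge2 k2; have L2 := natr_ge2 l2.
have K0 i : 0 < k%:R ^+ i :> rat by apply: exprn_gt0; lra.
have L0 i : 0 < l%:R ^+ i :> rat by apply: exprn_gt0; lra.
have hs' : 8 * T%:R < k%:R ^+ s :> rat.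
  by move: hs; rewrite -(ltr_nat rat) natrM !natrX.
have hP' : T%:R * (k%:R ^+ s + 1) < k%:R ^+ P :> rat.
  by move: hP; rewrite -(ltr_nat rat) natrM -natr1 !natrX.
have tT' := leq_natr1 tT; have t0 : 0 <= t%:R :> rat by rewrite ler0n.
have t'T' := leq_natr1 t'T; have t'0 : 0 <= t'%:R :> rat by rewrite ler0n.
have T1 : 1 <= T%:R :> rat by lra.
have [A AE] : exists A, A = k%:R ^+ P :> rat by eexists.
have [X XE] : exists X, X = l%:R ^+ Q :> rat by eexists.
have [V VE] : exists V, V = k%:R ^+ s :> rat by eexists.
rewrite -AE -VE in hP' hs'.
have A2T : 2 * T%:R < A.
  have : T%:R * 2 <= T%:R * (V + 1) by apply: ler_wpM2l; lra.
  lra.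
have X0 : 0 < X by rewrite XE; exact: L0.
have A0 : 0 < A by rewrite AE; exact: K0.
have V0 : 0 < V by rewrite VE; exact: K0.
(* [(al, be)] is the interval of all [th] in the cell of [(P, Q, t)]. *)
have [al alE] : exists al, al = (A - t%:R - 1) / X by eexists.
have [be beE] : exists be, be = (A - t%:R) / X by eexists.
have be0 : 0 < be by rewrite beE; apply: divr_gt0; lra.
have al0 : 0 < al by rewrite alE; apply: divr_gt0; lra.
(* A value in [0, T] at [(p, q)] puts [th] within [T / l ^ q = (T / k ^ p) * r] of
   [r = k ^ p / l ^ q]. This is at most [g p / 4] if [r <= be], and [g p / 2] if [r <= 2 * be]. *)
have [g gE] : exists g : nat -> rat, forall p, g p = 4 * T%:R * be / k%:R ^+ p.
  by eexists.
have g0 p : 0 < g p by rewrite gE; apply: divr_gt0 => //; apply: mulr_gt0; lra.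
have g_half p p' : (p < p')%N -> g p' <= g p / 2.
  move=> pp'.
  have -> : g p / 2 = 4 * T%:R * be / (k%:R ^+ p * 2) by rewrite gE; field; rewrite gt_eqF.
  rewrite gE; apply: ler_wpM2l; first by apply: mulr_ge0; lra.
  rewrite lef_pV2 ?posrE ?mulr_gt0 //.
  apply: (@le_trans _ _ (k%:R ^+ p.+1)); last by rewrite ler_weXn2l //; lra.
  by rewrite exprSr; apply: ler_wpM2l; [exact: ltW | lra].
have [de deE] : exists de, de = g (P + s)%N by eexists.
have de0 : 0 < de by rewrite deE.
have albe : be - al = X^-1 by rewrite beE alE; field; rewrite gt_eqF.
(* The choice [8 * T < k ^ s] keeps the interval nonempty after removing [de] at both ends. *)
have de_small : 2 * de < be - al.
  have -> : 2 * de = (A - t%:R) * (8 * T%:R) / (A * V) / X.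
    by rewrite deE gE beE exprD -AE -VE; field; rewrite !gt_eqF.
  rewrite albe -[ltRHS]mul1r ltr_pM2r ?invr_gt0 // ltr_pdivrMr ?mulr_gt0 // mul1r.
  apply: (@le_lt_trans _ _ (A * (8 * T%:R))).
    by apply: ler_wpM2r; lra.
  by rewrite ltr_pM2l.
pose R (p q : nat) := (P + s < p)%N /\
  al + de - g p < k%:R ^+ p / l%:R ^+ q < be - de + g p.
have [P' [Q' [[sP' /andP[R1 R2]] least]]] : exists p q, R p q /\
    forall p' q', (p' < p)%N -> ~ R p' q'.
  apply: least_fst.
  have [||p [q [pp /andP[x1 x2]]]] :=
    @ratio_dense k l (P + s) (al + de) (be - de) k2 l2 kl; [lra | lra |].
  by exists p, q; split=> //; have := g0 p; move=> ?; apply/andP; split; lra.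
exists P', Q'; split; first exact: leq_ltn_trans (leq_addr s P) sP'.
move=> th cth; move: (cth) => /andP[]; rewrite -natr1.
have [u uE] : exists u, u = k%:R ^+ P' :> rat by eexists.
have [w wE] : exists w, w = l%:R ^+ Q' :> rat by eexists.
rewrite -uE -wE in R1 R2 *.
move=> c1 c2.
have u0 : 0 < u by rewrite uE; exact: K0.
have w0 : 0 < w by rewrite wE; exact: L0.
have [rho rhoE] : exists rho, rho = u / w by eexists.
rewrite -rhoE in R1 R2.
have gP : g P' <= de / 2 by rewrite deE; apply: g_half.
have rho_be : rho < be by have := g0 P'; move=> ?; lra.
have th_rho : th < rho by rewrite rhoE ltr_pdivlMr //; lra.
have th_lo : al + de - 5 / 4 * g P' < th.
  have : rho - T%:R / w < th.
    by rewrite rhoE -mulrBl ltr_pdivrMr //; lra.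
  have : T%:R / w <= g P' / 4.
    have -> : T%:R / w = T%:R * rho / u by rewrite rhoE; field; rewrite !gt_eqF.
    have -> : g P' / 4 = T%:R * be / u by rewrite gE -uE; field; rewrite !gt_eqF.
    by rewrite ler_pM2r ?invr_gt0 // ler_wpM2l //; lra.
  lra.
have th_cell : cell k l P Q t th.
  have thal : al < th by lra.
  have thbe : th < be by lra.
  move: thal thbe; rewrite /cell -natr1 -AE -XE alE beE.
  rewrite ltr_pdivrMr // ltr_pdivlMr // => ? ?; apply/andP; split; lra.
split=> // p q /andP[Pp pP'].
have [pPs|Psp] := leqP p (P + s).
  by apply: (cell_no_hit_near k2 l2 kl hP tT th_cell); rewrite Pp pPs.
move=> /andP[h1 h2].
apply: (least p q pP'); split=> //.
have gp := g_half _ _ pP'; have gp0 := g0 p.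
have [y yE] : exists y, y = k%:R ^+ p :> rat by eexists.
have [z zE] : exists z, z = l%:R ^+ q :> rat by eexists.
rewrite -yE -zE in h1 h2 *.
have y0 : 0 < y by rewrite yE; exact: K0.
have z0 : 0 < z by rewrite zE; exact: L0.
have [r rE] : exists r, r = y / z by eexists.
have r_lo : th <= r by rewrite rE ler_pdivlMr //; lra.
have r_hi : r - T%:R / z <= th by rewrite rE -mulrBl ler_pdivrMr //; lra.
have Tz : T%:R / z = T%:R / y * r by rewrite rE; field; rewrite !gt_eqF.
rewrite -rE; apply/andP; split; first lra.
(* The case [r > 2 * be] is absurd: [k ^ p > 2 * T] gives [th >= r / 2 > be]. *)
have [r2|r2] := lerP r (2 * be).
  have : T%:R / y * r <= g p / 2.
    have -> : g p / 2 = T%:R / y * (2 * be).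
      by rewrite gE -yE; field; rewrite gt_eqF.
    by apply: ler_wpM2l => //; apply: divr_ge0; lra.
  rewrite -Tz; lra.
have yA : A <= y by rewrite AE yE ler_weXn2l //; [lra | exact: ltnW].
have : T%:R / y * r <= 2^-1 * r.
  apply: ler_wpM2r; first lra.
  by rewrite ler_pdivrMr //; lra.
rewrite -Tz; lra.
Qed.

(** * Sets of cells hit within windows of exponents *)

(** The unit interval is closed, as the formula can only use [<=] directly; prescribed hits lie in
    the open cell, so they never touch a neighbour. *)
Definition window_hit (k l P1 P2 y : nat) (th : rat) : Prop :=
  exists p q : nat, (P1 < p <= P2)%N /\
    y%:R <= k%:R ^+ p - th * l%:R ^+ q <= y.+1%:R.

(** Each element of [ts] costs one use of [next_hit]. No value falls in [0, T] between consecutive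
    hits, and [cell_hit_unique] excludes a second one at the same [p]. *)
Lemma window_hit_seq (k l T s : nat) (ts : seq nat) (P Q t : nat) :
  (2 <= k)%N -> (2 <= l)%N -> mult_independent k l -> (8 * T < k ^ s)%N ->
  {in ts, forall y, (y < T)%N} -> (T * (k ^ s).+1 < k ^ P)%N -> (t < T)%N ->
  exists P' Q' t' : nat, (P <= P')%N /\ (t' < T)%N /\
    forall th : rat, cell k l P' Q' t' th -> cell k l P Q t th /\
      forall y : nat, (y < T)%N -> window_hit k l P P' y th <-> y \in ts.
Proof.
move=> k2 l2 kl hs; elim: ts P Q t => [|t1 ts IH] P Q t tsT hP tT.
  exists P, Q, t; do 2![split=> //] => th c; split=> // y _.
  by split=> // -[p [q [/andP[]]]]; rewrite ltnNge => /negbTE ->.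
have t1T : (t1 < T)%N by apply: tsT; rewrite mem_head.
have [P1 [Q1 [PP1 H1]]] := @next_hit k l T s P Q t t1 k2 l2 kl hs hP tT t1T.
have hP1 : (T * (k ^ s).+1 < k ^ P1)%N.
  by apply: leq_trans hP _; rewrite leq_exp2l // ltnW.
have [|P' [Q' [t' [P1P' [t'T H]]]]] := IH P1 Q1 t1 _ hP1 t1T.
  by move=> y yts; apply: tsT; rewrite in_cons yts orbT.
exists P', Q', t'; split; first exact: leq_trans (ltnW PP1) P1P'.
split=> // th /H[c1 Hts]; have [c no] := H1 th c1; split=> // y yT.
have yT' : y.+1%:R <= T%:R :> rat by rewrite ler_nat.
have y0 : 0 <= y%:R :> rat by rewrite ler0n.
rewrite in_cons; split=> [[p [q [/andP[Pp pP'] hit]]]|].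
  have range : 0 <= k%:R ^+ p - th * l%:R ^+ q <= T%:R.
    case/andP: hit => h1 h2.
    by rewrite (le_trans y0 h1) (le_trans h2 yT').
  case: (ltngtP p P1) => [pP1|P1p|pP1].
  - by case: (no p q); rewrite ?Pp.
  - by apply/orP; right; apply/(Hts y yT); exists p, q; rewrite P1p.
  - apply/orP; left.
    rewrite pP1 in range hit.
    have T2 : (2 * T < k ^ P1)%N.
      apply: leq_ltn_trans hP1; rewrite mulnC leq_mul2l ltnS expn_gt0.
      by rewrite (leq_trans _ k2) ?orbT.
    have qQ := cell_hit_unique k2 l2 T2 t1T c1 range.
    (* One value lies strictly inside [(t1, t1 + 1)] and in [[y, y + 1]], so [y = t1]. *)
    rewrite qQ in hit; case/andP: c1 => c1 c2; case/andP: hit => h1 h2.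
    have := le_lt_trans h1 c2; have := lt_le_trans c1 h2.
    by rewrite !ltr_nat !ltnS => ? ?; rewrite eqn_leq; apply/andP.
case/orP => [/eqP ->|/(Hts y yT)[p [q [/andP[P1p pP'] hit]]]]; last first.
  by exists p, q; split=> //; rewrite pP' (ltn_trans PP1 P1p).
exists P1, Q1; rewrite PP1 P1P'; split=> //.
by case/andP: c1 => c1 c2; rewrite !ltW.
Qed.

(** The windows are laid end to end. Since the cells are nested, any [th] in the last one serves
    every window at once. *)
Lemma window_hit_seqs (k l T s : nat) (tss : seq (seq nat)) (P Q t : nat) :
  (2 <= k)%N -> (2 <= l)%N -> mult_independent k l -> (8 * T < k ^ s)%N ->
  {in tss, forall ts, {in ts, forall y, (y < T)%N}} ->
  (T * (k ^ s).+1 < k ^ P)%N -> (t < T)%N ->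
  exists P' Q' t' : nat, (P <= P')%N /\ (t' < T)%N /\
    (forall th : rat, cell k l P' Q' t' th -> cell k l P Q t th) /\
    {in tss, forall ts, exists P1 P2 : nat,
      forall th : rat, cell k l P' Q' t' th -> forall y : nat, (y < T)%N ->
        window_hit k l P1 P2 y th <-> y \in ts}.
Proof.
move=> k2 l2 kl hs; elim: tss P Q t => [|ts tss IH] P Q t tssT hP tT.
  by exists P, Q, t.
have tsT : {in ts, forall y, (y < T)%N} by apply: tssT; rewrite mem_head.
have [P1 [Q1 [t1 [PP1 [t1T H1]]]]] :=
  @window_hit_seq k l T s ts P Q t k2 l2 kl hs tsT hP tT.
have hP1 : (T * (k ^ s).+1 < k ^ P1)%N.
  by apply: leq_trans hP _; rewrite leq_exp2l.
have [|P' [Q' [t' [P1P' [t'T [sub H]]]]]] := IH P1 Q1 t1 _ hP1 t1T.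
  by move=> us ustss; apply: tssT; rewrite in_cons ustss orbT.
exists P', Q', t'; split; first exact: leq_trans PP1 P1P'.
split=> //; split=> [th /sub /H1 [] //|us].
rewrite in_cons => /orP[/eqP ->|/H //].
by exists P, P1 => th /sub /H1 [].
Qed.

Lemma power_windows (k l T : nat) (tss : seq (seq nat)) :
  (2 <= k)%N -> (2 <= l)%N -> mult_independent k l -> (0 < T)%N ->
  {in tss, forall ts, {in ts, forall y, (y < T)%N}} ->
  exists M N : nat, {in tss, forall ts, exists P1 P2 : nat,
    forall y : nat, (y < T)%N ->
      (exists p q : nat, (P1 < p <= P2)%N /\
        (k ^ M * y + l ^ (N + q) <= k ^ (M + p)
           <= k ^ M * y + l ^ (N + q) + k ^ M)%N) <-> y \in ts}.
Proof.
move=> k2 l2 kl T0 tssT.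
have K2 := natr_ge2 k2; have L2 := natr_ge2 l2.
(* The bound [m < k ^ m] meets both size conditions, with [s = 8 * T] and [T * (k ^ s + 1)] as
   starting exponent. *)
have hs : (8 * T < k ^ (8 * T))%N by apply: ltn_expl.
have hP : (T * (k ^ (8 * T)).+1 < k ^ (T * (k ^ (8 * T)).+1))%N by apply: ltn_expl.
have [P [Q [t [PP [tT [_ H]]]]]] :=
  @window_hit_seqs k l T (8 * T) tss (T * (k ^ (8 * T)).+1) 0 0 k2 l2 kl hs tssT hP T0.
have X0 : 0 < l%:R ^+ Q :> rat by apply: exprn_gt0; lra.
have t1A : t.+1%:R < k%:R ^+ P :> rat.
  rewrite -natrX ltr_nat; apply: leq_ltn_trans tT _.
  apply: leq_ltn_trans (leq_trans hP _); last by rewrite leq_exp2l.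
  by rewrite leq_pmulr.
have al0 : 0 < (k%:R ^+ P - t.+1%:R) / l%:R ^+ Q :> rat by rewrite divr_gt0 // subr_gt0.
have albe : (k%:R ^+ P - t.+1%:R) / l%:R ^+ Q < (k%:R ^+ P - t%:R) / l%:R ^+ Q :> rat.
  by rewrite ltr_pM2r ?invr_gt0 // -natr1; lra.
(* Density concerns [k ^ M / l ^ N], the inverse of [th], so the endpoints of the cell are inverted
   and swapped. *)
have [||M [N [_ /andP[r1 r2]]]] := @ratio_dense k l 0
  ((k%:R ^+ P - t%:R) / l%:R ^+ Q)^-1 ((k%:R ^+ P - t.+1%:R) / l%:R ^+ Q)^-1 k2 l2 kl.
- by rewrite invr_gt0 (lt_trans al0).
- by rewrite ltf_pV2 // posrE // (lt_trans al0).
exists M, N => ts /H [P1 [P2 Hts]]; exists P1, P2 => y yT.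
have M0 : 0 < k%:R ^+ M :> rat by apply: exprn_gt0; lra.
have N0 : 0 < l%:R ^+ N :> rat by apply: exprn_gt0; lra.
pose th : rat := l%:R ^+ N / k%:R ^+ M.
have th0 : 0 < th by rewrite divr_gt0.
have cth : cell k l P Q t th.
  have thV : k%:R ^+ M / l%:R ^+ N = th^-1 by rewrite /th invf_div.
  have be0 := lt_trans al0 albe.
  move: r1 r2; rewrite thV !ltf_pV2 ?posrE //.
  rewrite ltr_pdivlMr // ltr_pdivrMr // /cell => ? ?; apply/andP; split; lra.
rewrite -(Hts th cth y yT).
have scale p q : (k ^ M * y + l ^ (N + q) <= k ^ (M + p)
           <= k ^ M * y + l ^ (N + q) + k ^ M)%N =
    (y%:R <= k%:R ^+ p - th * l%:R ^+ q <= y.+1%:R).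
  rewrite -!(ler_nat rat) !natrD !natrM !natrX !exprD -natr1.
  rewrite -(ler_pM2l M0 y%:R) -(ler_pM2l M0 _ (y%:R + 1)).
  have -> : k%:R ^+ M * (k%:R ^+ p - th * l%:R ^+ q)
      = k%:R ^+ M * k%:R ^+ p - l%:R ^+ N * l%:R ^+ q :> rat.
    by rewrite /th; field; rewrite gt_eqF.
  by rewrite lerBrDr lerBlDr mulrDr mulr1; congr (_ && (_ <= _)); ring.
by split=> -[p [q [r h]]]; exists p, q; rewrite ?scale in h *.
Qed.

End Rational.

(** * The formula and the shattered grid *)

Definition plus (V : Type) (t u : term add_pow_language V) :
    term add_pow_language V :=
  @App add_pow_language V Add (fun i : 'I_2 => if val i == 0 then t else u).

(** Both terms already live under the quantifier over the difference, so no renaming of terms is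
    needed. *)
Definition le_formula (V : Type) (t u : term add_pow_language (option V)) :
    formula add_pow_language V :=
  FEx (FEq (plus t (Var None)) u).

Definition power_formula (V : Type) (r : pow_sym) (t : term add_pow_language V) :
    formula add_pow_language V :=
  @FRel add_pow_language V r (fun=> t).

Local Notation hit_var := (ip_var 4 (fun _ : 'I_2 => 1)).

(** The window for [u], a power of [k], is [[b 0, b 1]]; [b 2] is the least power of [l] allowed for
    [v], and [b 3] is the scale. Comparisons sit under three quantifiers, the power predicates under
    two. *)
Definition hit_formula : formula add_pow_language hit_var :=
  let out (x : hit_var) := Var (Some (Some (Some x))) in
  let b (i : nat) := out (inl (inord i)) in
  let u := Var (Some (Some None)) in
  let v := Var (Some None) in
  let y := plus (plus (out (inr (existT _ (ord0 : 'I_2) ord0)))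
                      (out (inr (existT _ (ord_max : 'I_2) ord0)))) v in
  FEx (FEx (FAnd (power_formula PowK (Var (Some None)))
           (FAnd (power_formula PowL (Var None))
           (FAnd (FAnd (le_formula (b 0) u) (le_formula u (b 1)))
           (FAnd (le_formula (b 2) v)
           (FAnd (le_formula y u) (le_formula u (plus y (b 3))))))))).

Lemma ex_addn (m n : nat) : (exists d, m + d = n) <-> m <= n.
Proof. by split=> [[d <-]|mn]; [exact: leq_addr | exists (n - m); exact: subnKC]. Qed.

Lemma sat_hit_formula (k l : nat) (b : 'I_4 -> nat) (a : 'I_2 -> 'I_1 -> nat) :
  @sat _ (nat_add_pow k l) _ (ip_env b a) hit_formula <->
  exists u v : nat, [/\ is_power k u, is_power l v,
    b (inord 0) <= u <= b (inord 1), b (inord 2) <= v &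
    a ord0 ord0 + a ord_max ord0 + v <= u
      <= a ord0 ord0 + a ord_max ord0 + v + b (inord 3)].
Proof.
split=> -[u [v]].
  move=> [/= ku [lv [[h1 h2] [h3 [h4 h5]]]]]; exists u, v.
  split; [exact: ku | exact: lv | apply/andP; split | | apply/andP; split];
  by apply/ex_addn.
move=> [ku lv /andP[/ex_addn h1 /ex_addn h2] /ex_addn h3 /andP[/ex_addn h4 /ex_addn h5]].
by exists u, v.
Qed.

Theorem theorem4p2 (k l : nat) (hk : 2 <= k) (hl : 2 <= l)
  (hkl : mult_independent k l) :
  independence_property 2 (complete_theory (nat_add_pow k l)).
Proof.
exists 4, (fun=> 1), hit_formula => n.
exists (nat_add_pow k l); split=> //.
pose code (j : {ffun 'I_2 -> 'I_n}) : nat := n * j ord0 + j ord_max.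
have codeT j : code j < (n * n).+1.
  by rewrite /code; have := ltn_ord (j ord0); have := ltn_ord (j ord_max); nia.
have code_inj : injective code.
  move=> j j' E.
  have n0 : 0 < n by apply: leq_ltn_trans (ltn_ord (j ord0)).
  have E1 : j ord_max = j' ord_max.
    apply: val_inj; have := congr1 (modn^~ n) E.
    by rewrite /code /= ![n * _]mulnC !modnMDl !modn_small.
  have E0 : j ord0 = j' ord0.
    by apply: val_inj; move: E; rewrite /code E1 => /addIn /eqP; rewrite eqn_pmul2l // => /eqP.
  apply/ffunP => i; case: (unliftP ord0 i) => [i' ->|-> //].
  by rewrite (_ : lift _ _ = ord_max) //; apply: val_inj; case: i' => -[].
pose codes (U : {set {ffun 'I_2 -> 'I_n}}) := [seq code j | j <- enum U].
(* All subsets are treated together, so that [M] and [N], and hence the grid elements, do not depend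
   on the subset. The successor keeps the bound positive when [n = 0]. *)
have [|M [N H]] := @power_windows k l (n * n).+1
    [seq codes U | U <- enum {set {ffun 'I_2 -> 'I_n}}] hk hl hkl isT.
  by move=> _ /mapP[U _ ->] _ /mapP[j _ ->].
exists (fun i (x : 'I_n) _ => if i == ord0 then k ^ M * (n * x) else k ^ M * x).
move=> U; have [|P1 [P2 {}H]] := H (codes U); first by rewrite map_f ?mem_enum.
(* The window excludes [P1], so its least power has exponent [M + P1.+1]. *)
exists (fun i => nth 0 [:: k ^ (M + P1.+1); k ^ (M + P2); l ^ N; k ^ M] i) => j.
rewrite sat_hit_formula /= !inordK //= -mulnDr -/(code j).
rewrite -[j \in U]mem_enum -(mem_map code_inj) -/(codes U) -(H _ (codeT j)).
split=> [[u [v [[i ->] [i' ->]]]]|[p [q [/andP[Pp pP] h]]]]; last first.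
  exists (k ^ (M + p)), (l ^ (N + q)); split=> //; try by [eexists].
  - by rewrite !leq_exp2l // !leq_add2l Pp.
  - by rewrite leq_exp2l // leq_addr.
rewrite !leq_exp2l // => /andP[i1 i2] i3 h.
(* The lower bounds on [u] and [v] force [M <= i] and [N <= i'], so these subtractions are exact. *)
exists (i - M), (i' - N); rewrite !subnKC //; last by lia.
by split=> //; lia.
Qed.
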